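(* Let $E,A\in\mathbb{R}^{c\times n}$, $B\in\mathbb{R}^{c\times m}$. Any two ODE-LTI systems associated with the DAE-LTI $\frac{d(Ex(t))}{dt}=Ax(t)+Bu(t)$ are feedback equivalent.
   Context: Throughout, matrices are real. An interval is a set $I\subseteq\mathbb{R}$ of the form $\mathbb{R}$, $[a,+\infty)$, $(-\infty,a]$ or $[a,b]$ with $a<b$. $L^1_{loc}(I,\mathbb{R}^q)$ is the set of measurable $f:I\to\mathbb{R}^q$ that are Lebesgue integrable on every compact interval $K\subseteq I$. $AC(I,\mathbb{R}^q)$ is the set of absolutely continuous functions $I\to\mathbb{R}^q$ (for unbounded $I$: absolutely continuous on every compact subinterval). ''a.e.'' means almost everywhere with respect to Lebesgue measure. A solution of the DAE-LTI $\frac{d(Ex(t))}{dt}=Ax(t)+Bu(t)$ on $I$ is a pair $(x,u)\in L^1_{loc}(I,\mathbb{R}^n)\times L^1_{loc}(I,\mathbb{R}^m)$ such that $Ex$ is absolutely continuous and $Ex(t)=Ex(t_0)+\int_{t_0}^t(Ax(s)+Bu(s))\,ds$ for all $t_0,t\in I$, $t\ge t_0$. $\mathcal{B}_I(E,A,B)$ is the set of all solutions on $I$, viewed also as a subset of $L^1_{loc}(I,\mathbb{R}^{n+m})$ by stacking $x$ and $u$. An ODE-LTI $(\widetilde A,G,\widetilde C,\widetilde D)$ with $\widetilde A\in\mathbb{R}^{r\times r}$, $G\in\mathbb{R}^{r\times s}$, $\widetilde C\in\mathbb{R}^{q\times r}$, $\widetilde D\in\mathbb{R}^{q\times s}$ is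 the system $\dot p=\widetilde Ap+Gw$, $z=\widetilde Cp+\widetilde Dw$. It is a realization of a set $\mathcal{B}\subseteq L^1_{loc}(I,\mathbb{R}^q)$ if (1) for every $z\in\mathcal{B}$ there exist $p\in AC(I,\mathbb{R}^r)$, $w\in L^1_{loc}(I,\mathbb{R}^s)$ with $\dot p=\widetilde Ap+Gw$ a.e. and $z=\widetilde Cp+\widetilde Dw$ a.e.; and (2) whenever $(p,w)\in AC(I,\mathbb{R}^r)\times L^1_{loc}(I,\mathbb{R}^s)$ satisfies $\dot p=\widetilde Ap+Gw$ a.e., there is $z\in\mathcal{B}$ with $z=\widetilde Cp+\widetilde Dw$ a.e. An ODE-LTI $(A_l,B_l,C_l,D_l)$ with $A_l\in\mathbb{R}^{\hat n\times\hat n}$, $B_l\in\mathbb{R}^{\hat n\times k}$, $C_l\in\mathbb{R}^{(n+m)\times\hat n}$, $D_l\in\mathbb{R}^{(n+m)\times k}$, $\hat n\le n$ ($\hat n=0$ allowed, with the usual conventions for empty matrices), is associated with the DAE-LTI if: (1) either $D_l=0$, $B_l=0$ and $k=1$, or $\mathrm{Rank}\,D_l=k$; (2) if $C_s,D_s$ denote the matrices formed by the first $n$ rows of $C_l,D_l$, then $ED_s=0$ and $\mathrm{Rank}\,EC_s=\hat n$; (3) $(A_l,B_l,C_l,D_l)$ is a realization of $\mathcal{B}_I(E,A,B)$ for every interval $I$. Two ODE-LTIs $(A_i,B_i,C_i,D_i)$, $i=1,2$, are feedback equivalent if there exist a matrix $K$ and nonsingular square matrices $U,T$ of suitable dimensions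 such that $(T(A_1+B_1K)T^{-1},\,TB_1U,\,(C_1+D_1K)T^{-1},\,D_1U)=(A_2,B_2,C_2,D_2)$. *)

(* Defs.v *)
From mathcomp Require Import all_boot all_order all_algebra.
From mathcomp Require Import all_classical all_reals all_analysis.

Set Implicit Arguments.
Unset Strict Implicit.
Unset Printing Implicit Defensive.

Import Order.TTheory GRing.Theory Num.Theory.
Import numFieldNormedType.Exports.

Local Open Scope classical_set_scope.
Local Open Scope ring_scope.

(* Functions on an interval I are represented by total functions on R of which
   only the values on I are constrained. Analytic notions for vector-valued
   functions are componentwise, which also makes sense in dimension 0. *)

Variant is_itv (R : realType) : set R -> Prop :=
| ItvLine : is_itv [set: R]
| ItvFrom (a : R) : is_itv `[a, +oo[
| ItvUpto (b : R) : is_itv `]-oo, b]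
| ItvSeg (a b : R) : a < b -> is_itv `[a, b].

(* R with the sigma-algebra of Lebesgue (and not just Borel) measurable sets,
   on which completed_lebesgue_measure is defined. *)
Definition lebesgueR (R : realType) :=
  caratheodory_type ((@wlength R idfun)^*)%mu.

Definition L1loc (R : realType) (I : set R) (q : nat) (f : R -> 'cV[R]_q) :=
  forall i : 'I_q,
    measurable_fun (I : set (lebesgueR R)) (fun t : lebesgueR R => f t i 0) /\
    forall a b : R, `[a, b] `<=` I ->
      (@completed_lebesgue_measure R).-integrable `[a, b] (fun t => (f t i 0)%:E).

Definition abs_cont_seg (R : realType) (a b : R) (f : R -> R) :=
  forall e : R, 0 < e -> exists2 d : R, 0 < d &
    forall (N : nat) (s t : 'I_N -> R),
      (forall j, [/\ a <= s j, s j <= t j & t j <= b]) ->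
      trivIset setT (fun j => `]s j, t j[%classic) ->
      \sum_j (t j - s j) < d ->
      \sum_j `|f (t j) - f (s j)| < e.

Definition AC (R : realType) (I : set R) (q : nat) (f : R -> 'cV[R]_q) :=
  forall a b : R, `[a, b] `<=` I ->
  forall i : 'I_q, abs_cont_seg a b (fun t => f t i 0).

Definition vint (R : realType) (q : nat) (a b : R) (f : R -> 'cV[R]_q) :
    'cV[R]_q :=
  \col_i (\int[@completed_lebesgue_measure R]_(s in `[a, b]) (f s i 0)).

Definition dae_solution (R : realType) (c n m : nat) (I : set R)
    (E A : 'M[R]_(c, n)) (B : 'M[R]_(c, m))
    (x : R -> 'cV[R]_n) (u : R -> 'cV[R]_m) :=
  [/\ L1loc I x, L1loc I u, AC I (fun t => E *m x t) &
      forall t0 t : R, I t0 -> I t -> t0 <= t ->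
        E *m x t = E *m x t0 + vint t0 t (fun s => A *m x s + B *m u s)].

Definition behavior (R : realType) (c n m : nat) (I : set R)
    (E A : 'M[R]_(c, n)) (B : 'M[R]_(c, m)) : set (R -> 'cV[R]_(n + m)) :=
  [set z | exists x u, dae_solution I E A B x u /\
                       z = (fun t => col_mx (x t) (u t))].

(* An equality between two systems includes the equality of their dimensions. *)
Record ode_lti (R : realType) (q : nat) := OdeLti {
  sdim : nat;
  idim : nat;
  mxA : 'M[R]_(sdim, sdim);
  mxB : 'M[R]_(sdim, idim);
  mxC : 'M[R]_(q, sdim);
  mxD : 'M[R]_(q, idim) }.

(* At the (negligible) endpoints of I the derivative may see values outside I,
   but this is irrelevant for a statement holding almost everywhere. *)
Definition ode_trajectory (R : realType) (q : nat) (I : set R)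
    (S : ode_lti R q) (p : R -> 'cV[R]_(sdim S)) (w : R -> 'cV[R]_(idim S)) :=
  [/\ AC I p, L1loc I w &
      {ae @completed_lebesgue_measure R, forall t, I t -> forall i,
        is_derive (t : R) (1 : R) (fun s : R => p s i 0 : R)
                  ((mxA S *m p t + mxB S *m w t) i 0)}].

Definition ode_output (R : realType) (q : nat) (I : set R)
    (S : ode_lti R q) (p : R -> 'cV[R]_(sdim S)) (w : R -> 'cV[R]_(idim S))
    (z : R -> 'cV[R]_q) :=
  {ae @completed_lebesgue_measure R, forall t, I t -> z t = mxC S *m p t + mxD S *m w t}.

Definition is_realization (R : realType) (q : nat) (I : set R)
    (S : ode_lti R q) (Bh : set (R -> 'cV[R]_q)) :=
  (forall z, Bh z ->
     exists (p : R -> 'cV[R]_(sdim S)) (w : R -> 'cV[R]_(idim S)),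
       ode_trajectory I p w /\ ode_output I p w z) /\
  (forall (p : R -> 'cV[R]_(sdim S)) (w : R -> 'cV[R]_(idim S)),
     ode_trajectory I p w -> exists2 z, Bh z & ode_output I p w z).

(* The number of inputs is at least 1: this is why the degenerate case is
   normalised to k = 1 rather than to a matrix D with no columns. *)
Definition is_associated (R : realType) (c n m : nat)
    (E A : 'M[R]_(c, n)) (B : 'M[R]_(c, m)) (S : ode_lti R (n + m)) :=
  [/\ (sdim S <= n)%N /\ (0 < idim S)%N,
      [/\ mxD S = 0, mxB S = 0 & idim S = 1%N] \/ \rank (mxD S) = idim S,
      E *m usubmx (mxD S) = 0 /\ \rank (E *m usubmx (mxC S)) = sdim S &
      forall I : set R, is_itv I -> is_realization I S (behavior I E A B)].

Definition feedback_equivalent (R : realType) (q : nat)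
    (S1 S2 : ode_lti R q) :=
  exists (K : 'M[R]_(idim S1, sdim S1)) (U : 'M[R]_(idim S1))
         (T : 'M[R]_(sdim S1)),
    [/\ U \in unitmx, T \in unitmx &
        OdeLti (T *m (mxA S1 + mxB S1 *m K) *m invmx T)
               (T *m mxB S1 *m U)
               ((mxC S1 + mxD S1 *m K) *m invmx T)
               (mxD S1 *m U) = S2].

(* Main.v *)
Require Import Defs.
From mathcomp Require Import all_boot all_order all_algebra.
From mathcomp Require Import all_classical all_reals all_analysis.
From mathcomp Require Import measurable_realfun ring lra.

Set Implicit Arguments.
Unset Strict Implicit.
Unset Printing Implicit Defensive.

Import Order.TTheory GRing.Theory Num.Theory.
Import numFieldNormedType.Exports.

Local Open Scope classical_set_scope.
Local Open Scope ring_scope.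

(** Only the interval [R] is needed.  Write [(A_i, B_i, C_i, D_i)] for the two
    systems and [M_i] for [E] times the first [n] rows of [C_i].  Both systems
    realize the same behavior, so every trajectory [(p1, w1)] of the first one
    has a companion trajectory [(p2, w2)] of the second one with the same output
    almost everywhere.  As [E] kills the first [n] rows of [D_i], applying [E]
    gives [M_1 p1 = M_2 p2] almost everywhere, hence everywhere by continuity;
    [M_2] has a left inverse [L], so [p2 = T p1] with [T = L M_1], a matrix that
    does not depend on the trajectory.

    Comparing the outputs, and the derivatives of [p2] and [T p1], shows that
    the two columns
      [(T A_1 - A_2 T) p1 + T B_1 w1]  and  [(C_1 - C_2 T) p1 + D_1 w1]
    are simultaneously [B_2 w2] and [D_2 w2], almost everywhere.  Belonging to
    the image of the stacked matrix [(B_2; D_2)] is a closed linear condition;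
    when [p1] and [w1] are continuous it therefore holds at every time, in
    particular at time [0].  The exponential of [(A_1 B_1; 0 0)] provides smooth
    trajectories with arbitrary values [p1(0)] and [w1(0)], so the columns of
    [(T A_1 - A_2 T; C_1 - C_2 T)] and of [(T B_1; D_1)] lie in the image of
    [(B_2; D_2)]: this is [realization_transfer].

    Exchanging the roles of the systems yields the inverse of [T], and the
    equality of the images of [(T B_1; D_1)] and [(B_2; D_2)].  The
    normalization of the [D_i] turns this equality into an invertible change of
    inputs [U] ([input_change]), and the inclusion of the other image provides
    the feedback [K]. *)

(** * The flow of a linear differential equation *)

Section LinearODE.
Variables (R : realType) (N : nat) (M : 'M[R]_N).

(** Coefficient of degree [k] in the [i]-th entry of [exp (t M) v]. *)
Definition flow_coef (v : 'cV[R]_N) (i : 'I_N) (k : nat) : R :=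
  iter k (mulmx M) v i 0 / k`!%:R.

(** The solution [exp (t M) v] of [y' = M y] with [y 0 = v], defined entrywise
    by its power series in [t]. *)
Definition flow (v : 'cV[R]_N) (t : R) : 'cV[R]_N :=
  \col_i limn (pseries (flow_coef v i) t).

Lemma pseries_diffs_flow_coef v i :
  pseries_diffs (flow_coef v i) = flow_coef (M *m v) i.
Proof.
apply/funext => k; rewrite /pseries_diffs /flow_coef -iterSr factS natrM invfM.
by rewrite mulrCA mulVKf ?pnatr_eq0.
Qed.

Lemma flow_coef_bound (v : 'cV[R]_N) i k :
  `|iter k (mulmx M) v i 0| <=
    (\sum_(i < N) \sum_(j < N) `|M i j|) ^+ k * \sum_(i < N) `|v i 0|.
Proof.
elim: k i => [|k IH] i.
  by rewrite expr0 mul1r /= (bigD1 i) //= lerDl sumr_ge0.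
rewrite iterS mxE (le_trans (ler_norm_sum _ _ _)) //.
apply: (@le_trans _ _ (\sum_(j < N) `|M i j| *
    ((\sum_(i < N) \sum_(j < N) `|M i j|) ^+ k * \sum_(i < N) `|v i 0|))).
  by apply: ler_sum => j _; rewrite normrM ler_wpM2l.
rewrite -mulr_suml exprS -mulrA ler_wpM2r //.
  by rewrite mulr_ge0 ?exprn_ge0 ?sumr_ge0 // => j _; rewrite sumr_ge0.
by rewrite [leRHS](bigD1 i) //= lerDl sumr_ge0 // => j _; rewrite sumr_ge0.
Qed.

Lemma is_cvg_flow v i t : cvgn (pseries (flow_coef v i) t).
Proof.
apply: normed_cvg.
(* The series is dominated by that of [b * expR (a * `|t|)]. *)
set a := \sum_(i < N) \sum_(j < N) `|M i j|; set b := \sum_(i < N) `|v i 0|.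
have a0 : 0 <= a by apply: sumr_ge0 => k _; apply: sumr_ge0.
have b0 : 0 <= b by apply: sumr_ge0.
apply: (@series_le_cvg _ _ (b *: exp_coeff (a * `|t|))).
- by move=> n /=.
- by move=> n; rewrite mulr_ge0 ?divr_ge0 ?exprn_ge0 ?mulr_ge0.
- move=> n; rewrite /= /flow_coef /exp_coeff !normrM normfV normr_nat normrX.
  rewrite -[leRHS]/(b * ((a * `|t|) ^+ n / n`!%:R)) exprMn.
  rewrite [leRHS](_ : _ = a ^+ n * b / n`!%:R * `|t| ^+ n); last by ring.
  by rewrite ler_wpM2r ?exprn_ge0 // ler_wpM2r // flow_coef_bound.
- by apply: is_cvg_seriesZ; exact: is_cvg_series_exp_coeff.
Qed.

Lemma flow0 v : flow v 0 = v.
Proof.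
apply/colP => i; rewrite mxE; apply: lim_near_cst => //.
near=> n; rewrite -[n]prednK; last by near: n.
rewrite /pseries /series /= big_nat_recl // big1 ?addr0.
  by rewrite expr0 mulr1 /flow_coef /= divr1.
by move=> k _; rewrite expr0n mulr0.
Unshelve. all: by end_near. Qed.

Lemma flow_mulmx v t : flow (M *m v) t = M *m flow v t.
Proof.
apply/colP => i; rewrite !mxE; apply: cvg_lim => //.
under eq_bigr do rewrite mxE.
have -> : pseries (flow_coef (M *m v) i) t =
    (fun n => \sum_(j < N) M i j * pseries (flow_coef v j) t n).
  apply/funext => n; rewrite /pseries /series /=.
  under [RHS]eq_bigr do rewrite mulr_sumr.
  rewrite exchange_big /=; apply: eq_bigr => k _.
  rewrite /flow_coef -iterSr iterS mxE !mulr_suml.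
  by apply: eq_bigr => j _; rewrite !mulrA.
apply: cvg_big => [|j _].
  exact: add_continuous.
by apply: cvgMl_tmp; exact: is_cvg_flow.
Qed.

Lemma is_derive_flow v t i :
  is_derive t (1 : R) (fun s => flow v s i 0) ((M *m flow v t) i 0).
Proof.
rewrite -flow_mulmx [flow (M *m v) t]/flow mxE -pseries_diffs_flow_coef.
rewrite (_ : (fun s => _) =
    fun s => limn (pseries (flow_coef v i) s)); last first.
  by apply/funext => s; rewrite mxE.
apply: (@pseries_snd_diffs _ _ (`|t| + 1));
  rewrite ?pseries_diffs_flow_coef; try exact: is_cvg_flow.
by rewrite [ltRHS]ger0_norm// ltrDl.
Qed.

End LinearODE.

(** * Absolute continuity, local integrability and null sets *)

Section Analysis.
Variable R : realType.

Lemma abs_cont_seg_derive (f df : R -> R) (a b : R) :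
  (forall t, is_derive t (1 : R) f (df t)) -> continuous df ->
  abs_cont_seg a b f.
Proof.
(* On [a, b] the derivative is bounded by some K, and d = e / K works. *)
move=> fdf cdf e e0.
have cf : continuous f.
  move=> t; apply: differentiable_continuous; apply/derivable1_diffP.
  by case: (fdf t).
have [K [K0 HK]] : exists K, 0 < K /\ forall t, a <= t <= b -> `|df t| <= K.
  have /compact_bounded[K [_ HK]] : compact (df @` `[a, b]).
    apply: continuous_compact; last exact: segment_compact.
    exact: continuous_subspaceT.
  exists (`|K| + 1); split; first by rewrite ltr_wpDl.
  move=> t tab; apply: HK; first by rewrite (le_lt_trans (ler_norm _))// ltrDl.
  by exists t => //; rewrite /= in_itv.
exists (e / K); first by rewrite divr_gt0.
move=> N s t st _; rewrite ltr_pdivlMr // => /(le_lt_trans _); apply.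
rewrite mulr_suml; apply: ler_sum => j _.
have [asj sjtj tjb] := st j.
have [|c + ->] := @MVT_segment _ f df _ _ sjtj (fun x _ => fdf x).
  exact: continuous_subspaceT.
rewrite in_itv /= => /andP[sc ct]; rewrite normrM mulrC.
rewrite (ger0_norm (_ : 0 <= t j - s j)) ?subr_ge0 // ler_wpM2l ?subr_ge0 //.
by rewrite HK // (le_trans asj sc) (le_trans ct tjb).
Qed.

Lemma abs_cont_seg_continuous (f : R -> R) :
  (forall a b, abs_cont_seg a b f) -> continuous f.
Proof.
move=> acf x; apply/cvgrPdist_lt => e e0.
have [d d0 Hd] := acf (x - 1) (x + 1) e e0.
near=> y.
have xy1 : `|x - y| < 1 by near: y; exact: cvgr_dist_lt.
have xyd : `|x - y| < d by near: y; exact: cvgr_dist_lt.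
(* The family reduced to the interval between x and y. *)
have := Hd 1%N (fun=> Num.min x y) (fun=> Num.max x y).
rewrite !big_ord1.
move: xy1 xyd => /ltr_normlP[? ?] /ltr_normlP[? ?].
have [xy|yx] := leP x y.
  rewrite distrC; apply.
  - by move=> _; split; lra.
  - by apply/trivIsetP => i j _ _; rewrite !ord1 eqxx.
  - lra.
apply.
- by move=> _; split; lra.
- by apply/trivIsetP => i j _ _; rewrite !ord1 eqxx.
- lra.
Unshelve. all: by end_near. Qed.

(** Borel sets are Lebesgue measurable. *)
Lemma measurable_lebesgueR (A : set R) :
  measurable (A : set (measurableTypeR R)) ->
  measurable (A : set (lebesgueR R)).
Proof. by move=> mA; exact: sub_caratheodory. Qed.

Lemma continuous_measurable_lebesgueR (f : R -> R) (A : set R) :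
  continuous f -> measurable (A : set (measurableTypeR R)) ->
  measurable_fun (A : set (lebesgueR R)) (f : lebesgueR R -> R).
Proof.
move=> cf mA _ Y mY; apply: measurable_lebesgueR; apply: measurableI => //.
by rewrite -[X in measurable X]setTI; exact: continuous_measurable_fun.
Qed.

Lemma L1loc_continuous (q : nat) (f : R -> 'cV[R]_q) :
  (forall i, continuous (fun t => f t i 0)) -> L1loc setT f.
Proof.
move=> cf i; split; first by apply: continuous_measurable_lebesgueR.
move=> a b _.
apply: (@measurable_bounded_integrable _ _ R (@completed_lebesgue_measure R)
  (fun t => f t i 0)).
- by apply: measurable_lebesgueR; exact: measurable_itv.
- (* On Borel sets, [completed_lebesgue_measure] and [lebesgue_measure] are
     the same outer measure. *)
  rewrite -[X in (X < _)%E]/(lebesgue_measure (`[a, b] : set R)).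
  rewrite lebesgue_measure_itv.
  by case: ifP => _; rewrite ?ltry //= -EFinB ltry.
- by apply: continuous_measurable_lebesgueR => //; exact: measurable_itv.
- have /compact_bounded : compact ((fun t => f t i 0) @` `[a, b]).
    apply: continuous_compact; last exact: segment_compact.
    exact: continuous_subspaceT.
  move=> [K [Kr HK]]; exists K; split=> // x Kx t tab.
  by apply: (HK x Kx); exists t.
Qed.

(** A nonempty open interval is not negligible. *)
Lemma ae_itv (P : R -> Prop) (a b : R) : a < b ->
  {ae @completed_lebesgue_measure R, forall t, P t} ->
  exists2 t, a < t < b & P t.
Proof.
move=> ab [N [mN N0 PN]]; apply: contrapT => nP.
have : (completed_lebesgue_measure (`]a, b[ : set (lebesgueR R)) <=
        completed_lebesgue_measure N)%E.
  apply: le_measure; rewrite ?inE //.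
    by apply: measurable_lebesgueR; exact: measurable_itv.
  move=> t; rewrite /= in_itv /= => tab; apply: PN => Pt.
  by apply: nP; exists t.
rewrite N0 -[X in (X <= _)%E]/(lebesgue_measure (`]a, b[ : set R)).
rewrite lebesgue_measure_itv /= lte_fin ab.
by rewrite -EFinB lee_fin leNgt subr_gt0 ab.
Qed.

Lemma continuous_ae_eq0 (f : R -> R) : continuous f ->
  {ae @completed_lebesgue_measure R, forall t, f t = 0} -> forall t, f t = 0.
Proof.
move=> cf f0 t; apply/eqP; apply: contrapT => /negP ft0.
have : \forall s \near t, f s != 0.
  exact: (cvgr_neq0 _ (cf t)) ft0.
move=> [e /= e0 He].
have [|s /andP[ts st] fs0] := @ae_itv _ t (t + e) _ f0; first by rewrite ltrDl.
suff : f s != 0 by rewrite fs0 eqxx.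
apply: He.
by rewrite /ball /= distrC gtr0_norm ?subr_gt0 // ltrBlDl.
Qed.

End Analysis.

(** * From equal behaviors to matrix identities *)

Section Transfer.
Variable R : realType.

Local Instance ae_completed_lebesgue_filter :
  Filter (almost_everywhere (@completed_lebesgue_measure R)).
Proof. exact: (ae_filter_ringOfSetsType (@completed_lebesgue_measure R)). Qed.

Lemma continuous_mulmx_col (a b : nat) (M : 'M[R]_(a, b)) (f : R -> 'cV[R]_b) :
  (forall j, continuous (fun t => f t j 0)) ->
  forall i, continuous (fun t => (M *m f t) i 0).
Proof.
move=> cf i.
have -> : (fun t => (M *m f t) i 0) = fun t => \sum_j M i j * f t j 0.
  by apply/funext => t; rewrite mxE.
move=> t; apply: cvg_big => [|j _].
  exact: add_continuous.
by apply: cvgMl_tmp; exact: cf.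
Qed.

Lemma is_derive_mulmx_col (a b : nat) (M : 'M[R]_(a, b)) (f : R -> 'cV[R]_b)
    (df : 'cV[R]_b) (t : R) :
  (forall j, is_derive t (1 : R) (fun s => f s j 0) (df j 0)) ->
  forall i, is_derive t (1 : R) (fun s => (M *m f s) i 0) ((M *m df) i 0).
Proof.
move=> fdf i.
have -> : (fun s => (M *m f s) i 0) = \sum_j (M i j \*: (fun s => f s j 0)).
  by apply/funext => s; rewrite mxE fct_sumE.
by rewrite mxE; apply: is_derive_sum => j; exact: is_deriveZ.
Qed.

Lemma continuous_ae_eq0_col (q : nat) (f : R -> 'cV[R]_q) :
  (forall i, continuous (fun t => f t i 0)) ->
  {ae @completed_lebesgue_measure R, forall t, f t = 0} -> forall t, f t = 0.
Proof.
move=> cf f0 t; apply/colP => i; rewrite mxE.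
apply: (@continuous_ae_eq0 _ (fun t => f t i 0)) => //.
by apply: filterS f0 => s ->; rewrite mxE.
Qed.

(** The state and the input are the two blocks of the flow of [(A B; 0 0)], so
    that the input is constant. *)
Lemma smooth_trajectory (q : nat) (S : ode_lti R q)
    (p0 : 'cV[R]_(sdim S)) (w0 : 'cV[R]_(idim S)) :
  exists (p : R -> 'cV[R]_(sdim S)) (w : R -> 'cV[R]_(idim S)),
    [/\ ode_trajectory setT p w, forall i, continuous (fun t => w t i 0),
        p 0 = p0 & w 0 = w0].
Proof.
pose M : 'M[R]_(sdim S + idim S) := block_mx (mxA S) (mxB S) 0 0.
pose y := flow M (col_mx p0 w0).
have dy t i : is_derive t (1 : R) (fun s => y s i 0) ((M *m y t) i 0).
  exact: is_derive_flow.
have cy i : continuous (fun t => y t i 0).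
  move=> t; apply: differentiable_continuous; apply/derivable1_diffP.
  by case: (dy t i).
have pE i : (fun t => usubmx (y t) i 0) = (fun t => y t (lshift _ i) 0).
  by apply/funext => t; rewrite mxE.
have wE i : (fun t => dsubmx (y t) i 0) = (fun t => y t (rshift _ i) 0).
  by apply/funext => t; rewrite mxE.
have y0 : y 0 = col_mx p0 w0 by exact: flow0.
exists (fun t => usubmx (y t)), (fun t => dsubmx (y t)); split.
- split.
  + move=> a b _ i; rewrite pE.
    apply: abs_cont_seg_derive (fun t => dy t _) _.
    exact: continuous_mulmx_col.
  + by apply: L1loc_continuous => i; rewrite wE.
  + apply: aeW => t _ i; rewrite pE.
    suff -> : (mxA S *m usubmx (y t) + mxB S *m dsubmx (y t)) i 0 =
              (M *m y t) (lshift _ i) 0 by exact: dy.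
    by rewrite -{3}[y t]vsubmxK mul_block_col col_mxEu.
- by move=> i; rewrite wE.
- by rewrite y0 col_mxKu.
- by rewrite y0 col_mxKd.
Qed.

(** The column space of [N] is the kernel of some matrix. *)
Lemma col_span_annihilator (F : fieldType) (r k : nat) (N : 'M[F]_(r, k)) :
  exists2 L : 'M[F]_r, L *m N = 0 &
    forall s (V : 'M[F]_(r, s)), L *m V = 0 -> exists X, V = N *m X.
Proof.
exists (cokermx N^T)^T.
  by apply: trmx_inj; rewrite trmx_mul trmxK mulmx_coker trmx0.
move=> s V LV0.
have /submxP[D VE] : (V^T <= N^T)%MS.
  by rewrite submxE -[V^T *m _]trmxK trmx_mul trmxK LV0 trmx0.
by exists D^T; rewrite -[V]trmxK VE trmx_mul trmxK.
Qed.

Lemma mulmx_col_inj (F : fieldType) (a b : nat) (M N : 'M[F]_(a, b)) :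
  (forall v : 'cV_b, M *m v = N *m v) -> M = N.
Proof.
move=> MN; apply/matrixP => i j.
by have /colP/(_ i) := MN (delta_mx j 0); rewrite -!colE !mxE.
Qed.

(** Applying [M] to an output removes the contribution of the input, and the
    left inverse [L] then recovers the state of [S2].  Hence [T] carries the
    state of any trajectory of [S1] to the state of a trajectory of [S2] with
    the same output.  Evaluating this on smooth trajectories with arbitrary
    initial data gives identities between matrices. *)
Lemma realization_transfer (q c : nat) (Bh : set (R -> 'cV[R]_q))
    (S1 S2 : ode_lti R q) (M : 'M[R]_(c, q)) (L : 'M[R]_(sdim S2, c))
    (T := L *m (M *m mxC S1)) :
  is_realization setT S1 Bh -> is_realization setT S2 Bh ->
  M *m mxD S1 = 0 -> M *m mxD S2 = 0 -> L *m (M *m mxC S2) = 1%:M ->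
  [/\ M *m mxC S1 = M *m mxC S2 *m T,
      exists X, col_mx (T *m mxB S1) (mxD S1) = col_mx (mxB S2) (mxD S2) *m X &
      exists Y, col_mx (T *m mxA S1 - mxA S2 *m T) (mxC S1 - mxC S2 *m T) =
                col_mx (mxB S2) (mxD S2) *m Y].
Proof.
move=> [_ r1] [r2 _] MD1 MD2 LMC2.
have [N N0 NP] := col_span_annihilator (col_mx (mxB S2) (mxD S2)).
set H := col_mx (T *m mxB S1) _; set G := col_mx (T *m mxA S1 - _) _.
(* All conclusions follow from their values on arbitrary initial data. *)
suff key (p0 : 'cV[R]_(sdim S1)) (w0 : 'cV[R]_(idim S1)) :
    M *m mxC S1 *m p0 = M *m mxC S2 *m T *m p0 /\
    N *m (G *m p0 + H *m w0) = 0.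
  split.
  - by apply: mulmx_col_inj => v; case: (key v 0).
  - apply: NP; apply: mulmx_col_inj => v; case: (key 0 v) => _.
    by rewrite mulmx0 add0r mulmxA mul0mx.
  - apply: NP; apply: mulmx_col_inj => v; case: (key v 0) => _.
    by rewrite mulmx0 addr0 mulmxA mul0mx.
have [p [w [pw cw <- <-]]] := smooth_trajectory p0 w0.
have [z zB z1] := r1 p w pw.
have [p2 [w2 [[ACp2 _ dp2] z2]]] := r2 z zB.
have [ACp _ dp] := pw.
have cp i : continuous (fun t => p t i 0).
  by apply: abs_cont_seg_continuous => a b; exact: ACp.
have cp2 i : continuous (fun t => p2 t i 0).
  by apply: abs_cont_seg_continuous => a b; exact: ACp2.
have Mp t : M *m mxC S1 *m p t = M *m mxC S2 *m p2 t.
  apply/eqP; rewrite -subr_eq0; apply/eqP; move: t.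
  apply: continuous_ae_eq0_col => [i|].
    have -> : (fun t => (M *m mxC S1 *m p t - M *m mxC S2 *m p2 t) i 0) =
        (fun t => (M *m mxC S1 *m p t) i 0 - (M *m mxC S2 *m p2 t) i 0).
      by apply/funext => t; rewrite !mxE.
    by move=> t; apply: cvgB; exact: continuous_mulmx_col.
  apply: filterS2 z1 z2 => t /(_ I) zt1 /(_ I) zt2; have := zt1; rewrite zt2.
  move/(congr1 (mulmx M)).
  rewrite !mulmxDr !mulmxA MD1 MD2 !mul0mx !addr0 => ->.
  by rewrite subrr.
have p2E t : p2 t = T *m p t.
  by rewrite -[p2 t]mul1mx -LMC2 -mulmxA -Mp mulmxA.
split; first by rewrite Mp p2E mulmxA.
(* By continuity in t it is enough to argue almost everywhere. *)
apply: (@continuous_ae_eq0_col _ (fun t => N *m (G *m p t + H *m w t))) => [|].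
  apply: continuous_mulmx_col => i.
  have -> : (fun t => (G *m p t + H *m w t) i 0) =
      (fun t => (G *m p t) i 0 + (H *m w t) i 0).
    by apply/funext => t; rewrite !mxE.
  by move=> t; apply: cvgD; exact: continuous_mulmx_col.
apply: filterS3 (filterI z1 z2) dp dp2.
move=> t [/(_ I) zt1 /(_ I) zt2] /(_ I) dpt /(_ I) dp2t.
suff -> : G *m p t + H *m w t = col_mx (mxB S2) (mxD S2) *m w2 t.
  by rewrite mulmxA N0 mul0mx.
(* Both sides are the derivative at t of p2 = T p. *)
have dE : T *m (mxA S1 *m p t + mxB S1 *m w t) =
    mxA S2 *m p2 t + mxB S2 *m w2 t.
  apply/colP => i; have := is_derive_mulmx_col T dpt i; have := dp2t i.
  have -> : (fun s => p2 s i 0) = (fun s => (T *m p s) i 0).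
    by apply/funext => s; rewrite p2E.
  by move=> [_ <-] [_ <-].
rewrite !mul_col_mx add_col_mx; congr col_mx.
  apply: (addrI (mxA S2 *m p2 t)); rewrite -dE p2E mulmxDr mulmxBl !mulmxA.
  by rewrite addrA addrCA addrN addr0.
apply: (addrI (mxC S2 *m p2 t)); rewrite -zt2 zt1 p2E mulmxBl !mulmxA.
by rewrite addrA addrCA addrN addr0.
Qed.

End Transfer.

(** * Feedback equivalence *)

Lemma mulmx_usubmx (F : pzRingType) (c n m s : nat) (E : 'M[F]_(c, n))
    (V : 'M[F]_(n + m, s)) : E *m usubmx V = row_mx E 0 *m V.
Proof. by rewrite -[V in RHS]vsubmxK mul_row_col mul0mx addr0. Qed.

(** Let [D1] and [D2] have the same column space, and [(B2; D2)] be obtained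
    from [(B1; D1)] by the combination of columns [X2].  If both pairs satisfy
    the normalization of associated systems, then they have the same number of
    columns and differ by an invertible change of inputs.  The casts transport
    the second pair along the equality of these numbers. *)
Lemma input_change (F : fieldType) (q r k1 k2 : nat)
    (D1 : 'M[F]_(q, k1)) (D2 : 'M[F]_(q, k2))
    (B1 : 'M[F]_(r, k1)) (B2 : 'M[F]_(r, k2))
    (X1 : 'M[F]_(k2, k1)) (X2 : 'M[F]_(k1, k2)) :
  (0 < k1)%N -> (0 < k2)%N ->
  [/\ D1 = 0, B1 = 0 & k1 = 1%N] \/ \rank D1 = k1 ->
  [/\ D2 = 0, B2 = 0 & k2 = 1%N] \/ \rank D2 = k2 ->
  D1 = D2 *m X1 -> D2 = D1 *m X2 -> B2 = B1 *m X2 ->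
  exists (eq_k : k1 = k2) (U : 'M[F]_k1),
    [/\ U \in unitmx, D1 *m U = castmx (erefl q, esym eq_k) D2 &
        B1 *m U = castmx (erefl r, esym eq_k) B2].
Proof.
move=> k1_gt0 k2_gt0 rk1 rk2 D12 D21 B21.
case: rk1 => [[D10 B10 k11]|rkD1]; case: rk2 => [[D20 B20 k21]|rkD2].
- subst k1 k2; exists erefl, 1%:M.
  by rewrite !castmx_id unitmx1 !mulmx1 D10 D20 B10 B20.
- by exfalso; move: k2_gt0; rewrite -rkD2 D21 D10 mul0mx mxrank0.
- by exfalso; move: k1_gt0; rewrite -rkD1 D12 D20 mul0mx mxrank0.
(* Both matrices have full column rank. *)
have eq_k : k1 = k2.
  have le12 : (\rank D1 <= \rank D2)%N by rewrite D12 mxrankM_maxl.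
  have le21 : (\rank D2 <= \rank D1)%N by rewrite D21 mxrankM_maxl.
  by apply/eqP; rewrite -rkD1 -[eqbRHS]rkD2 eqn_leq le12 le21.
subst k2; exists erefl, X2; rewrite !castmx_id -D21 -B21; split=> //.
rewrite -row_full_unit /row_full eqn_leq rank_leq_col /=.
by rewrite -{1}rkD2 D21 mxrankM_maxr.
Qed.

Theorem theorem3 (R : realType) (c n m : nat)
    (E A : 'M[R]_(c, n)) (B : 'M[R]_(c, m)) (S1 S2 : ode_lti R (n + m)) :
  is_associated E A B S1 -> is_associated E A B S2 ->
  feedback_equivalent S1 S2.
Proof.
case=> [[_ k1_gt0] rk1 [ED1 rkC1] real1] [[_ k2_gt0] rk2 [ED2 rkC2] real2].
have {real1}r1 := real1 _ (ItvLine R); have {real2}r2 := real2 _ (ItvLine R).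
rewrite !mulmx_usubmx in ED1 rkC1 ED2 rkC2.
set M := row_mx E 0 in ED1 rkC1 ED2 rkC2.
have [L1 L1C1] : exists L, L *m (M *m mxC S1) = 1%:M.
  by apply/row_fullP/eqP.
have [L2 L2C2] : exists L, L *m (M *m mxC S2) = 1%:M.
  by apply/row_fullP/eqP.
have [MC1 [X1 BD1] [Y G12]] := realization_transfer r1 r2 ED1 ED2 L2C2.
have [MC2 [X2 BD2] _] := realization_transfer r2 r1 ED2 ED1 L1C1.
have eq_n : sdim S1 = sdim S2.
  apply/eqP; rewrite -rkC1 -[eqbRHS]rkC2 eqn_leq.
  by rewrite [in leqLHS]MC1 mxrankM_maxl [in leqLHS]MC2 mxrankM_maxl.
set T := L2 *m _ in MC1 BD1 G12; set T' := L1 *m _ in MC2 BD2.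
have TT' : T *m T' = 1%:M by rewrite /T -mulmxA -MC2.
clearbody T T'; clear r1 r2.
case: S1 S2 => [n1 k1 A1 B1 C1 D1] [n2 k2 A2 B2 C2 D2] /= in
  k1_gt0 k2_gt0 rk1 rk2 ED1 rkC1 ED2 rkC2 L1 L1C1 L2 L2C2
    T T' TT' MC1 MC2 X1 X2 BD1 BD2 Y G12 eq_n *.
subst n2.
move: BD1 BD2 G12; rewrite !mul_col_mx.
move=> /eq_col_mx[TB1 D12] /eq_col_mx[TB2 D21] /eq_col_mx[TA TC].
have Tu : T \in unitmx by case: (mulmx1_unit TT').
have B21 : B2 = T *m B1 *m X2 by rewrite -mulmxA -TB2 mulmxA TT' mul1mx.
have rk1' : [/\ D1 = 0, T *m B1 = 0 & k1 = 1%N] \/ \rank D1 = k1.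
  by case: rk1 => [[-> -> ->]|]; [left; rewrite mulmx0|right].
have [eq_k [U [Uu DU BU]]] := input_change k1_gt0 k2_gt0 rk1' rk2 D12 D21 B21.
subst k2; rewrite castmx_id in DU; rewrite castmx_id in BU.
(* This feedback works because [T B1 X2 Y = B2 Y = T A1 - A2 T] and
   [D1 X2 Y = D2 Y = C1 - C2 T]. *)
exists (- (X2 *m Y)), U, T; split=> //=.
have -> : T *m (A1 + B1 *m - (X2 *m Y)) = A2 *m T.
  rewrite mulmxN mulmxBr !mulmxA -B21 -TA.
  by rewrite opprB addrCA addrN addr0.
have -> : C1 + D1 *m - (X2 *m Y) = C2 *m T.
  by rewrite mulmxN mulmxA -D21 -TC opprB addrCA addrN addr0.
by rewrite !mulmxK // BU DU.
Qed.
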